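(* Let $G$ and $H$ be fixed graphs. Then the function $k \mapsto \pi^{(H)}_G(k)$ is a polynomial in $k$; that is, there is a polynomial $p$ with real coefficients such that $\pi^{(H)}_G(k) = p(k)$ for every positive integer $k$.
   Context: All graphs are finite and simple. For a positive integer $k$, a $k$-colouring of a graph $G$ is a proper colouring $c\colon V(G)\to [k]=\{1,\dots,k\}$, i.e. $c(u)\neq c(v)$ whenever $uv\in E(G)$ (not all $k$ colours need be used). The $k$-colouring graph $\mathcal{C}_k(G)$ has as vertices the $k$-colourings of $G$, with an edge between two $k$-colourings if and only if they differ at precisely one vertex of $G$. For graphs $G$ and $H$, the generalised chromatic polynomial is the function $\pi^{(H)}_G$ where $\pi^{(H)}_G(k)$ is the number of subsets of $V(\mathcal{C}_k(G))$ that induce a subgraph of $\mathcal{C}_k(G)$ isomorphic to $H$. *)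

(* Defs.v *)
From HB Require Import structures.
From mathcomp Require Import all_boot all_order all_algebra.
From mathcomp Require Import boolp reals.

Set Implicit Arguments.
Unset Strict Implicit.
Unset Printing Implicit Defensive.

Record sgraph := SGraph {
  vertex :> finType;
  adj : rel vertex;
  adj_sym : symmetric adj;
  adj_irrefl : irreflexive adj
}.

Definition graph_iso (G H : sgraph) : Prop :=
  exists2 f : G -> H, bijective f & forall x y, adj (f x) (f y) = adj x y.

Section Induced.
Variables (G : sgraph) (S : {set G}).

Definition induced_adj : rel {x : G | x \in S} :=
  fun x y => adj (val x) (val y).

Lemma induced_adj_sym : symmetric induced_adj.
Proof. by move=> x y; apply: adj_sym. Qed.

Lemma induced_adj_irrefl : irreflexive induced_adj.
Proof. by move=> x; apply: adj_irrefl. Qed.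

Definition induced : sgraph := SGraph induced_adj_sym induced_adj_irrefl.

End Induced.

Section ColouringGraph.
Variables (k : nat) (G : sgraph).

(* The colour set {1, ..., k} is represented by 'I_k = {0, ..., k - 1}. *)
Definition proper_colouring (c : {ffun G -> 'I_k}) : bool :=
  [forall u, forall v, adj u v ==> (c u != c v)].

Definition colouring := {c : {ffun G -> 'I_k} | proper_colouring c}.

Definition colouring_adj : rel colouring :=
  fun c d => #|[set v | val c v != val d v]| == 1.

Lemma colouring_adj_sym : symmetric colouring_adj.
Proof.
move=> c d; rewrite /colouring_adj; congr (_ == _).
by apply: eq_card => v; rewrite !inE eq_sym.
Qed.

Lemma colouring_adj_irrefl : irreflexive colouring_adj.
Proof.
move=> c; rewrite /colouring_adj.
by rewrite (_ : [set v | _] = set0) ?cards0 //; apply/setP=> v; rewrite !inE eqxx.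
Qed.

Definition colouring_graph : sgraph :=
  SGraph colouring_adj_sym colouring_adj_irrefl.

End ColouringGraph.

Definition gen_chromatic (H G : sgraph) (k : nat) : nat :=
  #|[set S : {set colouring_graph k G} | `[< graph_iso (induced S) H >]]|.

(* Main.v *)
(** Sort the vertex sets [S] of induced copies of [H] by the set [U] of colours
    that occur in [S]. An injection of colours induces an embedding of
    colouring graphs, so the number of [S] with colour set [U] depends only on
    [j = #|U|]; call it [a_j]. Since [S] consists of [#|H|] colourings with at
    most [#|G|] colours each, [a_j = 0] for [j > #|H| * #|G|]. Hence the
    count is the sum over [j <= #|H| * #|G|] of ['C(k, j) * a_j], a polynomial
    in [k]. *)
Require Import Defs.
From HB Require Import structures.
From mathcomp Require Import all_boot all_order all_algebra.
From mathcomp Require Import boolp reals.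

Set Implicit Arguments.
Unset Strict Implicit.
Unset Printing Implicit Defensive.

Import GRing.Theory.
Local Open Scope ring_scope.

Lemma graph_iso_sym (G H : sgraph) : graph_iso G H -> graph_iso H G.
Proof.
case=> f [g fK gK] fadj; exists g; first by exists f.
by move=> x y; rewrite -fadj !gK.
Qed.

Lemma graph_iso_trans (G H K : sgraph) :
  graph_iso G H -> graph_iso H K -> graph_iso G K.
Proof.
case=> f bf fadj [g bg gadj]; exists (g \o f); first exact: bij_comp.
by move=> x y; rewrite /= gadj fadj.
Qed.

Lemma graph_iso_card (G H : sgraph) : graph_iso G H -> #|G| = #|H|.
Proof. by case=> f bf _; exact: bij_eq_card bf. Qed.

(** The restriction of [f] to [S] is injective, and it is onto because both vertex sets have [#|S|]
    elements. *)
Lemma induced_imset_iso (G H : sgraph) (f : G -> H) (S : {set G}) :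
  injective f -> (forall x y, adj (f x) (f y) = adj x y) ->
  graph_iso (induced S) (induced (f @: S)).
Proof.
move=> finj fadj.
pose h (x : induced S) : induced (f @: S) :=
  exist _ (f (val x)) (imset_f f (valP x)).
exists h; last by move=> x y; exact: fadj.
apply: inj_card_bij; first by move=> x y /(congr1 val) /= /finj /val_inj.
by rewrite !card_sig card_imset.
Qed.

Section Recolouring.
Variables (G : sgraph) (j k : nat) (i : 'I_j -> 'I_k).
Hypothesis i_inj : injective i.

Lemma recolour_proper (c : colouring j G) :
  proper_colouring [ffun v => i (val c v)].
Proof.
apply/forallP=> u; apply/forallP=> v; rewrite !ffunE (inj_eq i_inj).
by have /forallP/(_ u)/forallP/(_ v) := valP c.
Qed.

Definition recolour (c : colouring_graph j G) : colouring_graph k G :=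
  exist (fun d => is_true (@proper_colouring k G d)) _ (recolour_proper c).

Lemma recolour_inj : injective recolour.
Proof.
move=> c d /(congr1 val) /ffunP E; apply/val_inj/ffunP=> v.
by have := E v; rewrite !ffunE => /i_inj.
Qed.

Lemma recolour_adj (c d : colouring_graph j G) :
  adj (recolour c) (recolour d) = adj c d.
Proof.
congr (_ == _); apply: eq_card => v.
by rewrite !inE !ffunE (inj_eq i_inj).
Qed.

(** Pulling each colour back along [i] keeps the colouring proper: equal preimages would come from
    equal colours of [c]. *)
Lemma recolour_onto (c : colouring_graph k G) :
  (forall v, val c v \in codom i) -> exists d, c = recolour d.
Proof.
move=> ci; pose d := [ffun v => iinv (ci v)].
have dP : proper_colouring d.
  apply/forallP=> u; apply/forallP=> v; rewrite !ffunE.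
  have /forallP/(_ u)/forallP/(_ v) := valP c.
  case: (adj u v) => //= /eqP cuv; apply/eqP=> E; apply: cuv.
  by rewrite -(f_iinv (ci u)) -(f_iinv (ci v)) E.
exists (exist (fun d => is_true (@proper_colouring j G d)) d dP); apply/val_inj/ffunP=> v /=.
by rewrite !ffunE f_iinv.
Qed.

End Recolouring.

Section ColourSet.
Variable G : sgraph.

Definition colours k (S : {set colouring_graph k G}) : {set 'I_k} :=
  \bigcup_(c in S) [set val c v | v : G].

Lemma mem_colours k (S : {set colouring_graph k G}) c v :
  c \in S -> val c v \in colours S.
Proof. by move=> cS; apply/bigcupP; exists c => //; exact: imset_f. Qed.

Lemma card_colours k (S : {set colouring_graph k G}) :
  (#|colours S| <= #|S| * #|G|)%N.
Proof.
rewrite -sum_nat_const /colours.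
elim/big_rec2: _ => [|c A n _ nA]; first by rewrite cards0.
apply: leq_trans (leq_card_setU _ _) _.
by apply: leq_add => //; exact: leq_imset_card.
Qed.

Lemma colours_recolour j k (i : 'I_j -> 'I_k) (i_inj : injective i)
    (S : {set colouring_graph j G}) :
  colours (recolour i_inj @: S) = i @: colours S.
Proof.
apply/setP=> x; apply/bigcupP/imsetP.
  case=> _ /imsetP[c cS ->] /imsetP[v _ ->].
  by exists (val c v); [exact: mem_colours | rewrite ffunE].
case=> _ /bigcupP[c cS /imsetP[v _ ->]] ->.
exists (recolour i_inj c); first exact: imset_f.
by apply/imsetP; exists v => //; rewrite ffunE.
Qed.

Variable H : sgraph.

Definition copies k (U : {set 'I_k}) : {set {set colouring_graph k G}} :=
  [set S | `[< graph_iso (induced S) H >] && (colours S == U)].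

(** Enumerating [U] gives an injection [i] with image [U]. Recolouring along [i] maps the copies
    that use all [#|U|] colours bijectively onto those with colour set [U]. *)
Lemma card_copies k (U : {set 'I_k}) : #|copies U| = #|copies [set: 'I_#|U|]|.
Proof.
pose i : 'I_#|U| -> 'I_k := enum_val.
have i_inj : injective i by exact: enum_val_inj.
have iT : i @: [set: 'I_#|U|] = U.
  apply/setP=> x; apply/imsetP/idP=> [[y _ ->]|xU]; first exact: enum_valP.
  by exists (enum_rank_in xU x); rewrite // /i enum_rankK_in.
pose phi := recolour (G := G) i_inj.
have phi_inj : injective phi by exact: recolour_inj.
have isoE S : graph_iso (induced S) (induced (phi @: S)).
  by apply: induced_imset_iso => // c d; exact: recolour_adj.
rewrite -(card_imset _ (imset_inj phi_inj)); apply: eq_card => S.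
apply/idP/imsetP; last first.
  case=> S'; rewrite !inE => /andP[/asboolP isoS' /eqP colS'] ->.
  rewrite colours_recolour colS' iT eqxx andbT; apply/asboolP.
  exact: graph_iso_trans (graph_iso_sym (isoE S')) isoS'.
rewrite inE => /andP[/asboolP isoS /eqP colS].
(* Surjectivity: the colourings in [S] use only colours from [U], the image of [i], so each of them
   lies in the image of [phi]. *)
have defS : S = phi @: (phi @^-1: S).
  apply/setP=> c; apply/idP/imsetP=> [cS|[d]]; last by rewrite inE => dS ->.
  have [v|d cE] := recolour_onto i_inj (c := c).
    have := mem_colours v cS; rewrite colS -{1}iT => /imsetP[y _ ->].
    exact: codom_f.
  by exists d; rewrite // inE /phi -cE.
exists (phi @^-1: S) => //; rewrite inE; apply/andP; split.
  by apply/asboolP; apply: graph_iso_trans (isoE _) _; rewrite -defS.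
(* Taking images under [i] is injective on sets, so the colour set of the preimage can be compared
   with the full set after applying [i]. *)
rewrite -(inj_eq (imset_inj i_inj)) iT.
by rewrite -(colours_recolour i_inj) -/phi -defS colS.
Qed.

Lemma copies_eq0 k (U : {set 'I_k}) : (#|H| * #|G| < #|U|)%N -> #|copies U| = 0%N.
Proof.
move=> ltU; apply/eqP; rewrite cards_eq0; apply/eqP/setP=> S; rewrite !inE.
apply/negP=> /andP[/asboolP /graph_iso_card + /eqP colS].
rewrite card_sig => cardS.
by have := card_colours S; rewrite colS leqNgt cardS ltU.
Qed.

Lemma gen_chromatic_binomial k :
  gen_chromatic H G k =
  (\sum_(j < (#|H| * #|G|).+1) 'C(k, j) * #|copies [set: 'I_j]|)%N.
Proof.
pose N := (#|H| * #|G|)%N; pose a j := #|copies [set: 'I_j]|.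
have aN j : (N < j)%N -> a j = 0%N.
  by move=> Nj; apply: copies_eq0; rewrite cardsT card_ord.
have -> : gen_chromatic H G k = (\sum_(U : {set 'I_k}) a #|U|)%N.
  rewrite /gen_chromatic -sum1_card (partition_big (@colours k) predT) //=.
  apply: eq_bigr => U _; rewrite /a -card_copies -sum1_card.
  by apply: eq_bigl => S; rewrite !inE.
rewrite (bigID (fun U : {set 'I_k} => (#|U| < N.+1)%N)) /=.
rewrite [X in (_ + X)%N]big1 ?addn0; last by move=> U; rewrite ltnS -ltnNge => /aN.
(* Group the remaining [U] by size. The default value of [inord] never occurs, since only sets with
   [#|U| <= N] are left. *)
rewrite (partition_big (fun U : {set 'I_k} => inord #|U| : 'I_N.+1) predT) //=.
apply: eq_bigr => j _.
rewrite (eq_bigl (fun U : {set 'I_k} => U \in [set A : {set 'I_k} | #|A| == j])).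
  rewrite (eq_bigr (fun=> a j)); last by move=> U; rewrite inE => /eqP->.
  by rewrite sum_nat_const card_draws card_ord.
move=> U; rewrite inE; case: ltnP => [ltU|leU] /=.
  by rewrite -val_eqE /= inordK.
by apply/esym/negbTE; rewrite neq_ltn (leq_trans (ltn_ord j) leU) orbT.
Qed.

End ColourSet.

(** The product is the falling factorial as a polynomial; dividing it by [m!] will give the binomial
    coefficient. *)
Lemma horner_ffact (R : comNzRingType) (n m : nat) :
  (\prod_(i < m) ('X - i%:R%:P)).[n%:R] = (n ^_ m)%:R :> R.
Proof.
elim: m => [|m IH]; first by rewrite big_ord0 hornerC.
rewrite big_ord_recr /= hornerM IH hornerXsubC ffactnSr natrM.
(* Truncated [n - m] agrees with ring subtraction when [m <= n]; otherwise [n ^_ m = 0] makes both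
   sides vanish. *)
have [le_mn|lt_nm] := leqP m n; first by rewrite natrB.
by rewrite ffact_small // !mul0r.
Qed.

Theorem theorem1 (R : realType) (G H : sgraph) :
  exists p : {poly R},
    forall k : nat, (0 < k)%N -> (gen_chromatic H G k)%:R = p.[k%:R].
Proof.
exists (\sum_(j < (#|H| * #|G|).+1)
  (#|copies G H [set: 'I_j]|%:R / j`!%:R) *: \prod_(i < j) ('X - i%:R%:P)).
move=> k _; rewrite gen_chromatic_binomial natr_sum horner_sum.
apply: eq_bigr => j _; rewrite hornerZ horner_ffact -bin_ffact !natrM.
(* Since ['C(k, j) * j!] is the falling factorial, the division by [j!] in the coefficient
   cancels. *)
have fact_neq0 : j`!%:R != 0 :> R by rewrite Num.Theory.pnatr_eq0 -lt0n fact_gt0.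
by rewrite mulrACA mulVf // mulr1 mulrC.
Qed.
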